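(* Let $X$, $Y$, $Z$ be Hilbert spaces and let $\mathcal{L}:X\to Y$ be a bounded linear operator. Assume $\mathcal{L}$ can be factored as $\mathcal{L}=\mathcal{P}\mathcal{Q}$, where $\mathcal{P}:Z\to Y$ and $\mathcal{Q}:X\to Z$ are bounded linear operators. Assume that $\mathcal{P}$ is also bounded below, in the sense that there exists a constant $c>0$ such that $c\|z\|_Z\leq \|\mathcal{P}z\|_Y$ for every $z\in Z$. Then, for any $\varphi\in X$, $$\varphi\in\mathcal{R}(\mathcal{Q}^* )\quad\text{if and only if}\quad \mathcal{I}^{(0)}(\varphi):=\inf_{g\in X}\left\{\|\mathcal{L}g\|_Y \,:\, (g,\varphi)_X=1\right\}>0.$$
   Context: $\mathcal{R}(\cdot)$ denotes the range of an operator, $\mathcal{Q}^*:Z\to X$ the Hilbert space adjoint of $\mathcal{Q}$, and $\|\cdot\|_H$, $(\cdot,\cdot)_H$ the norm and inner product of a Hilbert space $H$. The infimum is taken in the extended reals, with $\inf\emptyset=+\infty$ (this only matters for $\varphi=0$, when no $g$ satisfies the constraint). *)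

(* Defs.v *)
From HB Require Import structures.
From mathcomp Require Import all_boot all_order all_algebra.
From mathcomp Require Import all_classical all_reals all_analysis.
From mathcomp Require Import -(notations) complex.

Set Implicit Arguments.
Unset Strict Implicit.
Unset Printing Implicit Defensive.

Import Order.TTheory GRing.Theory Num.Theory.
Import numFieldNormedType.Exports.

Local Open Scope classical_set_scope.
Local Open Scope ring_scope.

(* Hilbert spaces are over the reals or over the complex numbers; with
   [scalar_field R k] a statement covers both cases at once. *)
Inductive scalar_kind := RealScalars | ComplexScalars.

Definition scalar_field (R : realType) (k : scalar_kind) : numFieldType :=
  match k with
  | RealScalars => R
  | ComplexScalars => complex.complex R
  end.

Definition scalar_conj (R : realType) (k : scalar_kind) :
    scalar_field R k -> scalar_field R k :=
  match k with
  | RealScalars => idfun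
  | ComplexScalars => @Num.conj (complex.complex R)
  end.

Definition scalar_re (R : realType) (k : scalar_kind) : scalar_field R k -> R :=
  match k with
  | RealScalars => idfun
  | ComplexScalars => @complex.Re R
  end.

(* The inner product is linear in its first argument and conjugate-linear in
   the second one. *)
HB.mixin Record NormedModule_hasInner (R : realType) (k : scalar_kind) V
    of NormedModule (scalar_field R k) V := {
  inner : {dot V for @scalar_conj R k} ;
  sqr_norm_inner : forall x : V, `|x| ^+ 2 = inner x x
}.

#[short(type="hilbertType")]
HB.structure Definition Hilbert (R : realType) (k : scalar_kind) :=
  {V of CompleteNormedModule (scalar_field R k) V & NormedModule_hasInner R k V}.

Section HilbertOperators.
Context {R : realType} {k : scalar_kind}.

(* The norm of a normed module takes its values in the scalar field, as a
   nonnegative real scalar; [hnorm] is the corresponding real number. *)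
Definition hnorm (V : hilbertType R k) (x : V) : R := scalar_re `|x|.

Definition bounded_operator (V W : hilbertType R k) (f : {linear V -> W}) :=
  exists M : R, forall x, hnorm (f x) <= M * hnorm x.

Definition bounded_below (V W : hilbertType R k) (f : {linear V -> W}) :=
  exists2 c : R, 0 < c & forall x, c * hnorm x <= hnorm (f x).

(* By the Riesz representation theorem, the set below is a singleton when [f]
   is bounded; the value is meaningless otherwise. *)
Definition adjoint (V W : hilbertType R k) (f : {linear V -> W}) (w : W) : V :=
  get [set v | forall x, inner (f x) w = inner x v].

End HilbertOperators.

(* Main.v *)
(* If (Q x, w) = (x, phi) for all x, then (g, phi) = 1 forces 1 <= |Q g| |w|, and
   |L g| >= c |Q g|.  Conversely, a positive infimum gives, by homogeneity,
   |(x, phi)| <= C |Q x|; then Q x |-> (x, phi) is a well-defined bounded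
   functional on the range of Q, and the limit w of Q x_n along a minimizing
   sequence x_n of |Q x|^2 - 2 Re (x, phi) represents it, that is, Q^* w = phi.
   The same minimization with Q replaced by the identity yields the Riesz
   theorem, hence the existence of adjoints. *)
Require Import Defs.
From HB Require Import structures.
From mathcomp Require Import all_boot all_order all_algebra.
From mathcomp Require Import all_classical all_reals all_analysis.
From mathcomp Require Import ring lra.
From mathcomp Require Import -(notations) complex.

Set Implicit Arguments.
Unset Strict Implicit.
Unset Printing Implicit Defensive.

Import Order.TTheory GRing.Theory Num.Theory.
Import numFieldNormedType.Exports.

Local Open Scope classical_set_scope.
Local Open Scope ring_scope.

(** * Uniform treatment of real and complex scalars *)

Section Scalars.
Context {R : realType} {k : scalar_kind}.
Local Notation K := (scalar_field R k).
Local Notation conj := (@scalar_conj R k).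

(** Norms take values in [K], whereas infima and operator bounds live in [R]; this embedding carries
    inequalities between the two. *)
Definition scalar_of (r : R) : K :=
  match k return scalar_field R k with
  | RealScalars => r
  | ComplexScalars => complex.real_complex R r
  end.

Lemma scalar_reK (x : K) : x \is Num.real -> scalar_of (scalar_re x) = x.
Proof. by rewrite /scalar_of; case: k x => // x; exact: complex.RRe_real. Qed.

Lemma ler_scalar_of (r s : R) : (scalar_of r <= scalar_of s) = (r <= s).
Proof. by rewrite /scalar_of; case: k => //; rewrite complex.lecR. Qed.

Lemma ltr_scalar_of (r s : R) : (scalar_of r < scalar_of s) = (r < s).
Proof. by rewrite /scalar_of; case: k => //; rewrite complex.ltcR. Qed.

Lemma scalar_of0 : scalar_of 0 = 0.
Proof. by rewrite /scalar_of; case: k. Qed.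

Lemma scalar_ofD (r s : R) : scalar_of (r + s) = scalar_of r + scalar_of s.
Proof. by rewrite /scalar_of; case: k => //; exact: rmorphD. Qed.

Lemma scalar_of1 : scalar_of 1 = 1.
Proof. by rewrite /scalar_of; case: k. Qed.

Lemma scalar_ofM (r s : R) : scalar_of (r * s) = scalar_of r * scalar_of s.
Proof. by rewrite /scalar_of; case: k => //; exact: rmorphM. Qed.

Lemma scalar_conjM (a b : K) : conj (a * b) = conj a * conj b.
Proof. by case: k a b => // a b; exact: rmorphM. Qed.

Lemma scalar_conjD (a b : K) : conj (a + b) = conj a + conj b.
Proof. by case: k a b => // a b; exact: rmorphD. Qed.

Lemma scalar_conjN (a : K) : conj (- a) = - conj a.
Proof. by case: k a => // a; exact: rmorphN. Qed.

Lemma scalar_conj_real (a : K) : a \is Num.real -> conj a = a.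
Proof. by case: k a => // a; exact: conj_Creal. Qed.

Lemma mul_scalar_conj (a : K) : a * conj a = `|a| ^+ 2.
Proof.
case: k a => [a|a /=]; last by rewrite -normCK.
by rewrite real_normK ?num_real.
Qed.

Lemma norm_scalar_conj (a : K) : `|conj a| = `|a|.
Proof. by case: k a => // a; exact: norm_conjC. Qed.

(** The sum [a + conj a] serves as twice the real part of [a] without leaving [K]. *)
Lemma scalar_addconj_real (a : K) : a + conj a \is Num.real.
Proof.
case: k a => a; first exact: num_real.
by rewrite /= CrealE rmorphD /= conjCK addrC.
Qed.

Lemma scalar_addconj_le (a : K) : a + conj a <= 2%:R * `|a|.
Proof.
rewrite mulr_natl mulr2n -{2}(norm_scalar_conj a).
by rewrite (le_trans (real_ler_norm (scalar_addconj_real a)))// ler_normD.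
Qed.

(** Being comparable to the real [m], all values of [f] are real, so their infimum can be taken in
    [R] and approached within [e]. *)
Lemma approx_min (T : Type) (t0 : T) (f : T -> K) (m e : K) :
  m \is Num.real -> (forall t, m <= f t) -> 0 < e ->
  exists t, forall u, f t <= f u + e.
Proof.
move=> mR fm e0.
have fR t : f t \is Num.real by rewrite -(ler_real (fm t)).
pose A := [set scalar_re (f t) | t in [set: T]].
have hA : has_inf A.
  split; first by exists (scalar_re (f t0)), t0.
  exists (scalar_re m) => _ [t _ <-].
  by rewrite -ler_scalar_of !scalar_reK.
have eR : scalar_of (scalar_re e) = e by rewrite scalar_reK ?gtr0_real.
have e'0 : 0 < scalar_re e by rewrite -ltr_scalar_of scalar_of0 eR.
have [_ [t _ <-] ht] := inf_adherent e'0 hA.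
exists t => u; rewrite -(scalar_reK (fR t)) -(scalar_reK (fR u)) -eR -scalar_ofD.
rewrite ler_scalar_of (le_trans (ltW ht))// lerD2r.
by apply: ge_inf; [case: hA | exists u].
Qed.

(* The witnesses are the real multiples [- s * conj a] of [conj a]; the optimal
   one is [s = 1 / N]. *)
Lemma quadratic_ge0_discriminant (a N e : K) : 0 <= N ->
  (forall t : K, 0 <= t * a + conj (t * a) + `|t| ^+ 2 * N + e) ->
  `|a| ^+ 2 <= e * N.
Proof.
move=> N0 h.
have e0 : 0 <= e.
  by have := h 0; rewrite mul0r scalar_conj_real ?real0// normr0 expr0n !mul0r !add0r.
have [->|a0] := eqVneq a 0; first by rewrite normr0 expr0n mulr_ge0.
have sa : 0 < `|a| ^+ 2 by rewrite exprn_gt0 ?normr_gt0.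
have {}h s : 0 < s -> 0 <= - (s * 2%:R) * `|a| ^+ 2 + s ^+ 2 * `|a| ^+ 2 * N + e.
  move=> s0; have := h (- s * conj a).
  have -> : - s * conj a * a = - s * `|a| ^+ 2 by rewrite -mul_scalar_conj; ring.
  rewrite scalar_conj_real ?realM ?realN ?gtr0_real ?normr_gt0//.
  rewrite normrM normrN (gtr0_norm s0) norm_scalar_conj exprMn.
  by congr (is_true (0 <= _)); ring.
move: (`|a| ^+ 2) sa h => A A0 h.
have [N00|Nn0] := eqVneq N 0.
  (* For [N = 0] the bound is affine in [s]; at [s = (e + 1) / A] it equals [- (e + 2) < 0]. *)
  have := h _ (divr_gt0 (ltr_wpDl e0 ltr01) A0).
  have -> : - ((e + 1) / A * 2%:R) * A = - (e + 1) * 2%:R.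
    by rewrite mulrAC mulNr mulfVK ?gt_eqF// mulNr.
  rewrite N00 mulr0 addr0 (_ : _ + e = - (e + 2%:R)); last by ring.
  by rewrite oppr_ge0 => /(lt_le_trans (ltr_wpDl e0 (ltr0n _ 2))); rewrite ltxx.
have Np : 0 < N by rewrite lt_def Nn0.
have Vp : 0 < N^-1 by rewrite invr_gt0.
have := h _ Vp.
have -> : N^-1 ^+ 2 * A * N = A / N by rewrite mulrAC expr2 mulfVK// mulrC.
rewrite (_ : _ + _ = e - A / N); last by ring.
by rewrite subr_ge0 ler_pdivrMr.
Qed.

End Scalars.

(** * Inner products and the Cauchy-Schwarz inequality *)

Section Hilbert.
Context {R : realType} {k : scalar_kind}.
Local Notation K := (scalar_field R k).
Local Notation conj := (@scalar_conj R k).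

Lemma inner_conj (V : hilbertType R k) (x y : V) : inner x y = conj (inner y x).
Proof. by rewrite hermitian_subproof expr0 mul1r. Qed.

Lemma inner_add_scale (V : hilbertType R k) (t : K) (x v : V) :
  inner (x + t *: v) (x + t *: v) = inner x x +
    (t * inner v x + conj (t * inner v x)) + `|t| ^+ 2 * inner v v.
Proof.
rewrite linearDl !linearDr linearZl_LR linearZr_LR linearZl_LR linearZr_LR /=.
rewrite scalar_conjM -inner_conj -mul_scalar_conj; ring.
Qed.

Lemma inner_ge0 (V : hilbertType R k) (x : V) : 0 <= inner x x.
Proof. by rewrite -sqr_norm_inner exprn_ge0. Qed.

(** The squared norm of [y + t *: x] is a nonnegative quadratic in [t], so the discriminant bound
    applies. *)
Lemma cauchy_schwarz (V : hilbertType R k) (x y : V) :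
  `|inner x y| <= `|x| * `|y|.
Proof.
rewrite -(@ler_pXn2r _ 2%N) ?nnegrE ?mulr_ge0// exprMn mulrC.
rewrite !sqr_norm_inner; apply: quadratic_ge0_discriminant => [|t]; first exact: inner_ge0.
have := inner_ge0 (y + t *: x); rewrite inner_add_scale; congr (is_true (0 <= _)); ring.
Qed.

Lemma inner_inj (V : hilbertType R k) (x y : V) :
  (forall v, inner v x = inner v y) -> x = y.
Proof.
move=> h; apply/eqP; rewrite -subr_eq0 -normr_eq0 -sqrf_eq0 sqr_norm_inner.
by rewrite linearBr subr_eq0; apply/eqP/h.
Qed.

(** * Representing a functional dominated by [|T x|] *)

Section Representation.
Variables (X Z : hilbertType R k) (T : {linear X -> Z}) (l : X -> K).
Hypothesis l_scalar : scalar l.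
Variable C : K.
Hypothesis C_ge0 : 0 <= C.
Hypothesis l_le : forall x, `|l x| <= C * `|T x|.

(** A near-minimizer [x] of [|T x|^2 - 2 Re (l x)] nearly solves the Euler equation: its defect of
    minimality along [x + t *: v] is a quadratic in [t] whose linear coefficient is the residual at
    [v]. *)
Lemma approx_representation (e : K) : 0 < e ->
  exists x, forall v, `|inner (T v) (T x) - l v| <= e * `|T v|.
Proof.
move=> e0; pose J x := inner (T x) (T x) - (l x + conj (l x)).
(* Completing the square: [|T x|^2 - 2 C |T x| + C^2 >= 0]. *)
have J_ge x : - C ^+ 2 <= J x.
  rewrite /J -sqr_norm_inner lerBrDr.
  apply: (@le_trans _ _ (- C ^+ 2 + 2%:R * `|l x|)).
    by rewrite lerD2l scalar_addconj_le.
  apply: (@le_trans _ _ (- C ^+ 2 + 2%:R * (C * `|T x|))).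
    by rewrite lerD2l ler_pM2l.
  rewrite -subr_ge0.
  have -> : `|T x| ^+ 2 - (- C ^+ 2 + 2%:R * (C * `|T x|)) = (`|T x| - C) ^+ 2.
    ring.
  by rewrite real_exprn_even_ge0// realB// ger0_real.
(* The tolerance is [e ^+ 2] because the discriminant bounds the square of the residual. *)
have [||x hx] := @approx_min R k X 0 J (- C ^+ 2) (e ^+ 2) _ J_ge.
- by rewrite realN realX// ger0_real.
- by rewrite exprn_gt0.
exists x => v.
rewrite -(@ler_pXn2r _ 2%N) ?nnegrE ?mulr_ge0// ?(ltW e0)// exprMn.
rewrite sqr_norm_inner; apply: quadratic_ge0_discriminant => [|t]; first exact: inner_ge0.
have := hx (x + t *: v); rewrite -subr_ge0 /J linearD linearZ inner_add_scale.
have -> : l (x + t *: v) = t * l v + l x by rewrite addrC l_scalar.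
rewrite mulrBr !scalar_conjD scalar_conjN; congr (is_true (0 <= _)); ring.
Qed.

(* The filter generated by the images [S e] of the sets of [e]-approximate
   solutions replaces a minimizing sequence. *)
Lemma riesz_representation : exists w, forall x, inner (T x) w = l x.
Proof.
pose S (e : K) : set Z :=
  [set T x | x in [set x | forall v, `|inner (T v) (T x) - l v| <= e * `|T v|]].
pose F := filter_from [set e : K | 0 < e] S.
have FF : ProperFilter F.
  apply: filter_from_proper => [|e e0].
    apply: filter_from_filter => [|d e /= d0 e0]; first by exists 1 => /=.
    have de : 0 < d + e by rewrite addr_gt0.
    have Ssub (a b : K) : a <= b -> S a `<=` S b.
      move=> ab _ [x hx <-]; exists x => // v.
      by rewrite (le_trans (hx v))// ler_wpM2r.
    (* A positive scalar below both [d] and [e], in place of their minimum. *)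
    exists (d * e / (d + e)); first by rewrite /= divr_gt0 ?mulr_gt0.
    by rewrite subsetI; split; apply: Ssub;
      rewrite ler_pdivrMr// mulrDr ?lerDr ?[e * d]mulrC ?lerDl mulr_ge0 ?ltW.
  by have [x hx] := approx_representation e0; exists (T x), x.
have Fcvg : cvg F.
  apply/cauchy_cvgP/cauchy_exP => e e0.
  (* Subtracting the residuals of two [e / 3]-approximate solutions at their difference [z] gives
     [|T z|^2 <= (2 e / 3) |T z|], so [S (e / 3)] lies in a ball of radius [e]. *)
  have e3 : 0 < e / 3%:R by rewrite divr_gt0.
  have [x hx] := approx_representation e3.
  exists (T x), (e / 3%:R) => // _ [y hy <-].
  rewrite -ball_normE /= -linearB.
  set z := x - y.
  have [->|Tz0] := eqVneq (T z) 0; first by rewrite normr0.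
  have Tz_gt0 : 0 < `|T z| by rewrite normr_gt0.
  rewrite -(ltr_pM2r Tz_gt0) -expr2 sqr_norm_inner -(ger0_norm (inner_ge0 _)).
  have -> : inner (T z) (T z) =
      (inner (T z) (T x) - l z) - (inner (T z) (T y) - l z).
    by rewrite -[in RHS]addrA opprB addKr -linearBr -linearB.
  rewrite (le_lt_trans (ler_normB _ _))//.
  rewrite (le_lt_trans (lerD (hx z) (hy z)))// -mulrDl ltr_pM2r// -subr_gt0.
  by have -> : e - (e / 3%:R + e / 3%:R) = e / 3%:R by field.
have /cvg_ex[w Fw] := Fcvg.
exists w => v; apply/eqP; rewrite -subr_eq0 -normr_le0.
(* By domination [l] vanishes on the kernel of [T]. *)
have [Tv0|Tv0] := eqVneq (T v) 0.
  have /eqP lv0 : l v == 0.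
    by rewrite -normr_le0 (le_trans (l_le v))// Tv0 normr0 mulr0.
  by rewrite Tv0 lv0 linear0l subr0 normr0.
have Tv : 0 < `|T v| by rewrite normr_gt0.
rewrite real_leNgt ?real0 ?normr_real//; apply/negP => a0.
(* With half the relative defect, the distance from [w] to [T x] and the residual of [x] together
   fall strictly short of the whole defect. *)
pose e : K := `|inner (T v) w - l v| / `|T v| / 2%:R.
have e0 : 0 < e by rewrite !divr_gt0.
have Fb : F (ball w e) by apply: Fw; exact: nbhsx_ballx.
have FS : F (S e) by exists e.
have [z [wz [x hx xz]]] := filter_ex (filterI Fb FS).
move: wz; rewrite -ball_normE /= -xz => wx.
have : `|inner (T v) w - l v| < e * `|T v| + e * `|T v|.
  have -> : inner (T v) w - l v =
      inner (T v) (w - T x) + (inner (T v) (T x) - l v).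
    by rewrite linearBr; ring.
  rewrite (le_lt_trans (ler_normD _ _))// ltr_leD//.
  by rewrite (le_lt_trans (cauchy_schwarz _ _))// mulrC ltr_pM2r.
by rewrite -mulrDl -splitr mulfVK ?gt_eqF// ltxx.
Qed.

End Representation.

(** * Adjoints of bounded operators *)

Lemma scalar_of_hnorm (V : hilbertType R k) (x : V) : scalar_of (hnorm x) = `|x|.
Proof. by rewrite /hnorm scalar_reK ?normr_real. Qed.

Lemma bounded_operatorP (V W : hilbertType R k) (f : {linear V -> W}) :
  bounded_operator f -> exists2 M : R, 0 < M & forall x, hnorm (f x) <= M * hnorm x.
Proof.
move=> [M hM]; exists (`|M| + 1) => [|x]; first by rewrite ltr_wpDl.
rewrite (le_trans (hM x))// ler_wpM2r//.
  by rewrite -(@ler_scalar_of _ k) scalar_of0 scalar_of_hnorm.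
by rewrite (le_trans (ler_norm M))// lerDl.
Qed.

Lemma adjointP (V W : hilbertType R k) (f : {linear V -> W}) (w : W) (x : V) :
  bounded_operator f -> inner (f x) w = inner x (adjoint f w).
Proof.
move=> /bounded_operatorP[M M0 hM].
have [|||v hv] := @riesz_representation V V idfun (fun x => inner (f x) w) _
  (scalar_of M * `|w|).
- by move=> a u v; rewrite linearP linearPl.
- by rewrite mulr_ge0// -scalar_of0 ler_scalar_of ltW.
- move=> v; rewrite (le_trans (cauchy_schwarz _ _))// mulrAC ler_wpM2r//.
  by rewrite -!scalar_of_hnorm -scalar_ofM ler_scalar_of.
have : [set v | forall x, inner (f x) w = inner x v] v by move=> y; rewrite -hv.
by move=> /getI; exact.
Qed.

(** Trades the value chosen by [get] for a weak equation, the form that [riesz_representation]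
    delivers. *)
Lemma range_adjointP (V W : hilbertType R k) (f : {linear V -> W}) (v : V) :
  bounded_operator f ->
  range (adjoint f) v <-> exists w, forall x, inner (f x) w = inner x v.
Proof.
move=> bf; split=> [[w _ <-]|[w hw]]; first by exists w => x; rewrite adjointP.
by exists w => //; apply: inner_inj => x; rewrite -adjointP.
Qed.

End Hilbert.

Theorem theorem1 (R : realType) (k : scalar_kind) (X Y Z : hilbertType R k)
    (L : {linear X -> Y}) (P : {linear Z -> Y}) (Q : {linear X -> Z})
    (L_bounded : bounded_operator L)
    (P_bounded : bounded_operator P)
    (Q_bounded : bounded_operator Q)
    (L_factored : forall x : X, L x = P (Q x))
    (P_bounded_below : bounded_below P)
    (phi : X) :
  phi \in range (adjoint Q) <->
  (0 < ereal_inf [set (hnorm (L g))%:E | g in [set g : X | inner g phi = 1%R]])%E.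
Proof.
rewrite inE range_adjointP//; split=> [[w hw]|inf_gt0].
  have [c c0 hc] := P_bounded_below.
  have w0 : 0 <= hnorm w.
    by rewrite -(@ler_scalar_of _ k) scalar_of0 scalar_of_hnorm.
  (* The [+ 1] keeps the denominator positive when [w = 0]. *)
  apply: (@lt_le_trans _ _ (c / (hnorm w + 1))%:E).
    by rewrite lte_fin divr_gt0// ltr_wpDl.
  apply: le_ereal_inf_tmp => _ [g /= g1 <-].
  rewrite lee_fin ler_pdivrMr ?ltr_wpDl// L_factored.
  have h1 : 1 <= hnorm (Q g) * hnorm w.
    rewrite -(@ler_scalar_of _ k) scalar_of1 scalar_ofM !scalar_of_hnorm.
    by rewrite (le_trans _ (cauchy_schwarz _ _))// hw g1 normr1.
  have := hc (Q g); have := ler_wpM2l (ltW c0) h1.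
  nra.
have [m m0 hm] : exists2 m : R, 0 < m &
    forall g, inner g phi = 1 -> m <= hnorm (L g).
  have le_inf g : inner g phi = 1 -> (ereal_inf [set (hnorm (L g))%:E |
      g in [set g : X | inner g phi = 1%R]] <= (hnorm (L g))%:E)%E.
    by move=> g1; apply: ereal_inf_lbound; exists g.
  (* A finite infimum is itself the bound; an infinite one means that no [g] meets the constraint,
     and [1] will do. *)
  case: (ereal_inf _) inf_gt0 le_inf => [m m0 le_inf|_ le_inf|//].
    by exists m => // g /le_inf; rewrite lee_fin.
  by exists 1 => // g /le_inf; rewrite leye_eq.
have [M M0 hM] := bounded_operatorP P_bounded.
(* For [b = (x, phi)] nonzero, [b^-1 *: x] meets the constraint, so
   [m <= |P (Q x)| / |b| <= M |Q x| / |b|], whence the constant [M / m]. *)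
apply: (@riesz_representation _ _ _ _ _ _ _ (scalar_of (M / m))).
- by move=> a u v; rewrite linearPl.
- by rewrite -scalar_of0 ler_scalar_of divr_ge0// ltW.
move=> x; set b := inner x phi.
have [->|b0] := eqVneq b 0.
  by rewrite normr0 mulr_ge0// -scalar_of0 ler_scalar_of divr_ge0// ltW.
have /hm : inner (b^-1 *: x) phi = 1 by rewrite linearZl_LR mulVf.
rewrite L_factored => /le_trans/(_ (hM _)).
rewrite -(@ler_scalar_of _ k) scalar_ofM scalar_of_hnorm linearZ normrZ normfV.
rewrite mulrCA mulrC ler_pdivlMr ?normr_gt0// => h.
have Vm : scalar_of m^-1 * scalar_of m = 1 :> scalar_field R k.
  by rewrite -scalar_ofM mulVf ?gt_eqF// scalar_of1.
rewrite -[leLHS]mul1r -Vm -mulrA scalar_ofM [scalar_of M * _]mulrC -mulrA.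
by rewrite ler_wpM2l// -scalar_of0 ler_scalar_of invr_ge0 ltW.
Qed.
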